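(* Let $\Theta$ be a program, let $\mathcal{T}$ be a type name declared in $\Theta$, and let $\mathcal{X}_{\mathcal{T}}(\Theta)$ denote the defunctionalization $\mathcal{D}_{\mathcal{T}}(\Theta)$ if $\mathcal{T}$ is declared as a codata type in $\Theta$, and the refunctionalization $\mathcal{R}_{\mathcal{T}}(\Theta)$ if $\mathcal{T}$ is declared as a data type in $\Theta$. Then for all contexts $\Gamma$, telescopes $\Xi$, expressions $e,e_1,e_2,t$ and substitutions $\sigma,\sigma_1,\sigma_2$: (1) $\Gamma\vdash_\Theta e:t$ implies $\Gamma\vdash_{\mathcal{X}_{\mathcal{T}}(\Theta)} e:t$; (2) $\Gamma\vdash_\Theta e_1\equiv e_2:t$ implies $\Gamma\vdash_{\mathcal{X}_{\mathcal{T}}(\Theta)} e_1\equiv e_2:t$; (3) $\Gamma\vdash_\Theta \sigma:\Xi$ implies $\Gamma\vdash_{\mathcal{X}_{\mathcal{T}}(\Theta)}\sigma:\Xi$; (4) $\Gamma\vdash_\Theta \sigma_1\equiv\sigma_2:\Xi$ implies $\Gamma\vdash_{\mathcal{X}_{\mathcal{T}}(\Theta)}\sigma_1\equiv\sigma_2:\Xi$; (5) $\vdash_\Theta\Gamma\ \mathrm{ctx}$ implies $\vdash_{\mathcal{X}_{\mathcal{T}}(\Theta)}\Gamma\ \mathrm{ctx}$; (6) $\Gamma\vdash_\Theta\Xi\ \mathrm{tel}$ implies $\Gamma\vdash_{\mathcal{X}_{\mathcal{T}}(\Theta)}\Xi\ \mathrm{tel}$.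
   Context: **Syntax.** Fix disjoint sets of type names $\mathcal T$, producer names $\mathrm C$, consumer names $\mathrm d$ and variables $x,z,\dots$. Expressions: $e,s,t ::= x\mid \mathrm{Type}\mid \mathcal T\rho\mid \mathrm C\sigma\mid e.\mathrm d\sigma$. Substitutions: $\rho,\sigma ::= ()\mid(e,\sigma)$. Contexts: $\Gamma::=\emptyset\mid\Gamma,x:t$. Telescopes: $\Xi,\Psi::=\emptyset\mid x:t,\Xi$ (later types may mention earlier variables; a closed telescope may be used as a context; $\Xi_1;\Xi_2$ is concatenation). Everything is taken up to renaming of bound variables, with distinct telescopes using distinct variables. $[\sigma/\Xi]$ replaces the variables of $\Xi$ by the components of $\sigma$. A program $\Theta$ is a finite list of mutually recursive, well-scoped declarations, each of one of the forms: - data type: $\mathbf{data}\ \mathcal T\Psi\{\overline{\mathrm C\,\Xi:\mathcal T\rho}\}$, introducing the type name $\mathcal T$ and constructors $\mathrm C$ ($\rho$ in scope of $\Xi$); - definition: $\mathbf{def}\ (z:\mathcal T\rho).\mathrm d\,\Xi:t\{\overline a\}$, with $\mathcal T$ a data type, $\rho$ in scope of $\Xi$, $t$ in scope of $\Xi,z$, and exactly one case $a$ for each constructor $\mathrm C\,\Xi':\mathcal T\rho'$ of $\mathcal T$, either $\mathrm C\,\Xi'\mapsto e$ ($e$ in scope of $\Xi;\Xi'$) or $\mathrm C\,\Xi'\ \mathbf{absurd}$; - codata type: $\mathbf{codata}\ \mathcal T\Psi\{\overline{(z:\mathcal T\rho).\mathrm d\,\Xi:t}\}$, introducing $\mathcal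 T$ and destructors $\mathrm d$ (scoping as for definitions); - codefinition: $\mathbf{codef}\ \mathrm C\,\Xi:\mathcal T\rho\{\overline o\}$, with $\mathcal T$ a codata type and exactly one cocase $o$ for each destructor $(z:\mathcal T\rho').\mathrm d\,\Xi':t$ of $\mathcal T$, either $\mathrm d\,\Xi'\mapsto e$ ($e$ in scope of $\Xi;\Xi'$) or $\mathrm d\,\Xi'\ \mathbf{absurd}$. Each name is declared at most once in $\Theta$. **Judgments** (simultaneously inductively defined, relative to $\Theta$). Contexts: $\vdash_\Theta\emptyset\ \mathrm{ctx}$; $\vdash_\Theta\Gamma,x:t\ \mathrm{ctx}$ if $\vdash_\Theta\Gamma\ \mathrm{ctx}$ and $\Gamma\vdash_\Theta t:\mathrm{Type}$. Telescopes: $\Gamma\vdash_\Theta\emptyset\ \mathrm{tel}$ if $\vdash_\Theta\Gamma\ \mathrm{ctx}$; $\Gamma\vdash_\Theta (x:t,\Xi)\ \mathrm{tel}$ if $\Gamma\vdash_\Theta t:\mathrm{Type}$ and $\Gamma,x:t\vdash_\Theta\Xi\ \mathrm{tel}$. Substitutions: $\Gamma\vdash_\Theta():\emptyset$ if $\vdash_\Theta\Gamma\ \mathrm{ctx}$; $\Gamma\vdash_\Theta(e,\sigma):(x:t,\Xi)$ if $\Gamma\vdash_\Theta e:t$ and $\Gamma\vdash_\Theta\sigma:\Xi[e/x]$. Equality of substitutions: $\Gamma\vdash_\Theta()\equiv():\emptyset$ if $\vdash_\Theta\Gamma\ \mathrm{ctx}$; $\Gamma\vdash_\Theta(e,\sigma)\equiv(e',\sigma'):(x:t,\Xi)$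 if $\Gamma\vdash_\Theta e\equiv e':t$ and $\Gamma\vdash_\Theta\sigma\equiv\sigma':\Xi[e/x]$. Typing: if $\vdash_\Theta\Gamma\ \mathrm{ctx}$ then $\Gamma\vdash_\Theta x:t$ for $(x:t)\in\Gamma$, and $\Gamma\vdash_\Theta\mathrm{Type}:\mathrm{Type}$. Conversion: $\Gamma\vdash_\Theta e:t$ and $\Gamma\vdash_\Theta t\equiv t':\mathrm{Type}$ give $\Gamma\vdash_\Theta e:t'$. Formation: if $\mathcal T\Psi$ is declared as a data or codata type and $\Gamma\vdash_\Theta\rho:\Psi$, then $\Gamma\vdash_\Theta\mathcal T\rho:\mathrm{Type}$. Introduction: if $\mathrm C\,\Xi:\mathcal T\rho$ is a constructor of a data type or the signature of a codefinition in $\Theta$ and $\Gamma\vdash_\Theta\sigma:\Xi$, then $\Gamma\vdash_\Theta\mathrm C\sigma:\mathcal T\rho[\sigma/\Xi]$. Elimination: if $(z:\mathcal T\rho).\mathrm d\,\Xi:t$ is the signature of a definition or a destructor of a codata type in $\Theta$, $\Gamma\vdash_\Theta\sigma:\Xi$ and $\Gamma\vdash_\Theta e:\mathcal T\rho[\sigma/\Xi]$, then $\Gamma\vdash_\Theta e.\mathrm d\sigma:t[\sigma/\Xi][e/z]$. Judgmental equality $\Gamma\vdash_\Theta e\equiv e':t$: the least relation closed under reflexivity (on typed expressions), symmetry, transitivity, conversion of $t$, the congruence rules for $\mathcal T\rho$, $\mathrm C\sigma$ and $e.\mathrm d\sigma$ (obtained from the typing rules by replacing the typing premises by equalities, the type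 being that of the left-hand side), and the computation rules: suppose $\Gamma\vdash_\Theta\sigma_1:\Xi_1$, $\Gamma\vdash_\Theta\sigma_2:\Xi_2$, $\Gamma\vdash_\Theta\rho_1[\sigma_1/\Xi_1]\equiv\rho_2[\sigma_2/\Xi_2]:\Psi$, and either (data) $\mathcal T\Psi$ is a data type in $\Theta$ with constructor $\mathrm C\,\Xi_1:\mathcal T\rho_1$ and $\mathbf{def}\ (z:\mathcal T\rho_2).\mathrm d\,\Xi_2:t\{\mathrm C\,\Xi_1\mapsto e,\dots\}\in\Theta$, or (codata) $\mathcal T\Psi$ is a codata type in $\Theta$ with destructor $(z:\mathcal T\rho_2).\mathrm d\,\Xi_2:t$ and $\mathbf{codef}\ \mathrm C\,\Xi_1:\mathcal T\rho_1\{\mathrm d\,\Xi_2\mapsto e,\dots\}\in\Theta$; then $\Gamma\vdash_\Theta\mathrm C\sigma_1.\mathrm d\sigma_2\equiv e[\sigma_1/\Xi_1][\sigma_2/\Xi_2]:t[\sigma_2/\Xi_2][\mathrm C\sigma_1/z]$ (the two substitutions act on disjoint sets of variables and are understood simultaneously). **Transformations.** If $\mathcal T$ is a codata type in $\Theta$, the program $\mathcal D_{\mathcal T}(\Theta)$ is obtained from $\Theta$ by replacing the declaration $\mathbf{codata}\ \mathcal T\Psi\{\dots\}$ and all codefinitions of type $\mathcal T$ by: a data type $\mathbf{data}\ \mathcal T\Psi\{\dots\}$ having one constructor $\mathrm C\,\Xi_1:\mathcal T\rho_1$ for each codefinition $\mathbf{codef}\ \mathrm C\,\Xi_1:\mathcal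 T\rho_1\{\dots\}$ of $\Theta$; and, for each destructor $(z:\mathcal T\rho_2).\mathrm d\,\Xi_2:t$, a definition $\mathbf{def}\ (z:\mathcal T\rho_2).\mathrm d\,\Xi_2:t\{\dots\}$ whose case for $\mathrm C$ is $\mathrm C\,\Xi_1\mapsto e$ if the cocase for $\mathrm d$ in the codefinition $\mathrm C$ is $\mathrm d\,\Xi_2\mapsto e$, and $\mathrm C\,\Xi_1\ \mathbf{absurd}$ if that cocase is absurd. All other declarations are unchanged. If $\mathcal T$ is a data type in $\Theta$, $\mathcal R_{\mathcal T}(\Theta)$ is the inverse transformation: constructors become codefinitions, definitions on $\mathcal T$ become destructors of the codata type $\mathcal T$, and the cocase for $\mathrm d$ in the codefinition $\mathrm C$ is taken from the case for $\mathrm C$ in the definition $\mathrm d$. *)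

(* Defs.v *)
From Stdlib Require List.
From mathcomp Require Import all_boot.

Set Implicit Arguments.
Unset Strict Implicit.
Unset Printing Implicit Defensive.

(* The judgments of a dependent type theory with data and codata types, in
   de Bruijn style, and the two transformations (defunctionalization and
   refunctionalization) that exchange data and codata types.

   Expressions are taken up to renaming of bound variables: [Var i] refers to
   the i-th most recently bound variable.  Since expressions contain no binders,
   substitution never goes under a binder except in [subst_tel]. *)

(* Three sorts of names: types, producers (constructors and codefinitions) and
   consumers (destructors and definitions).  They are injected into the syntax
   by different constructors, so they are disjoint by construction. *)
Record names := Names { tname : eqType; pname : eqType; cname : eqType }.

Section Syntax.
Variable N : names.

Inductive expr : Type :=
| Var of nat
| Typ
| TyCon of tname N & seq expr
| Prod of pname N & seq expr
| Dest of expr & cname N & seq expr.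

(* [:: e_1; ...; e_n], in the order of the telescope being instantiated. *)
Definition substitution := seq expr.

(* A telescope lists its types in order of declaration; the type at position i
   lives in the scope of the ambient context followed by the i earlier
   variables.  In particular a closed telescope is literally the same list in
   every ambient context, so placing it in a context needs no weakening. *)
Definition telescope := seq expr.

(* A context lists its types with the most recent one first; each type lives in
   the scope of the rest of the list. *)
Definition context := seq expr.

Fixpoint subst_expr (s : nat -> expr) (e : expr) : expr :=
  match e with
  | Var i => s i
  | Typ => Typ
  | TyCon T r => TyCon T (map (subst_expr s) r)
  | Prod C r => Prod C (map (subst_expr s) r)
  | Dest e d r => Dest (subst_expr s e) d (map (subst_expr s) r)
  end.

Definition rename (f : nat -> nat) : expr -> expr :=
  subst_expr (fun i => Var (f i)).

Definition up (s : nat -> expr) (i : nat) : expr :=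
  if i is j.+1 then rename succn (s j) else Var 0.

Fixpoint subst_tel (s : nat -> expr) (Xi : telescope) : telescope :=
  if Xi is t :: Xi' then subst_expr s t :: subst_tel (up s) Xi' else [::].

(* The simultaneous substitution replacing the last [size sigma] variables by
   the components of [sigma] (the last component replaces [Var 0]). *)
Definition inst (sigma : substitution) (i : nat) : expr :=
  if i < size sigma then nth Typ sigma (size sigma - i.+1)
  else Var (i - size sigma).

Definition bound (G : context) (i : nat) (t : expr) : Prop :=
  i < size G /\ t = rename (addn i.+1) (nth Typ G i).

Fixpoint scoped (n : nat) (e : expr) : bool :=
  match e with
  | Var i => i < n
  | Typ => true
  | TyCon _ r => all (scoped n) r
  | Prod _ r => all (scoped n) r
  | Dest e _ r => scoped n e && all (scoped n) r
  end.

Fixpoint scoped_tel (n : nat) (Xi : telescope) : bool :=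
  if Xi is t :: Xi' then scoped n t && scoped_tel n.+1 Xi' else true.

(* C Xi : T rho; the type name T is stored in the enclosing declaration. *)
Record psig := PSig {
  p_name : pname N;
  p_tel : telescope;
  p_args : substitution }.

(* (z : T rho).d Xi : t; T is stored in the enclosing declaration, and
   [c_ret] lives in the scope of Xi, z (z is [Var 0]). *)
Record csig := CSig {
  c_name : cname N;
  c_tel : telescope;
  c_args : substitution;
  c_ret : expr }.

(* The body [None] stands for "absurd".  The telescope that a (co)case rebinds
   is that of the corresponding constructor (destructor), so it is not stored.
   The body of a case lives in the scope of the telescope of the definition
   followed by that of the constructor; the body of a cocase in the scope of
   the telescope of the codefinition followed by that of the destructor. *)
Inductive decl : Type :=
| Data of tname N & telescope & seq psig
| Def of tname N & csig & seq (pname N * option expr)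
| Codata of tname N & telescope & seq csig
| Codef of tname N & psig & seq (cname N * option expr).

Definition program_text := seq decl.
Implicit Types (Th : program_text) (D : decl).

Definition type_names_of D : seq (tname N) :=
  match D with
  | Data T _ _ | Codata T _ _ => [:: T]
  | Def _ _ _ | Codef _ _ _ => [::]
  end.

Definition producer_names_of D : seq (pname N) :=
  match D with
  | Data _ _ cs => map p_name cs
  | Codef _ c _ => [:: p_name c]
  | Def _ _ _ | Codata _ _ _ => [::]
  end.

Definition consumer_names_of D : seq (cname N) :=
  match D with
  | Codata _ _ ds => map c_name ds
  | Def _ d _ => [:: c_name d]
  | Data _ _ _ | Codef _ _ _ => [::]
  end.

Definition type_names Th := flatten (map type_names_of Th).
Definition producer_names Th := flatten (map producer_names_of Th).
Definition consumer_names Th := flatten (map consumer_names_of Th).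

Definition scoped_psig (c : psig) : bool :=
  scoped_tel 0 (p_tel c) && all (scoped (size (p_tel c))) (p_args c).

Definition scoped_csig (d : csig) : bool :=
  [&& scoped_tel 0 (c_tel d), all (scoped (size (c_tel d))) (c_args d)
    & scoped (size (c_tel d)).+1 (c_ret d)].

Definition wf_decl Th D : Prop :=
  match D with
  | Data T Psi cs => scoped_tel 0 Psi && all scoped_psig cs
  | Codata T Psi ds => scoped_tel 0 Psi && all scoped_csig ds
  | Def T d cases =>
      scoped_csig d /\
      exists Psi cs,
        [/\ List.In (Data T Psi cs) Th,
            perm_eq (unzip1 cases) (map p_name cs)
          & forall c e, List.In c cs -> List.In (p_name c, Some e) cases ->
              scoped (size (c_tel d) + size (p_tel c)) e]
  | Codef T c cocases =>
      scoped_psig c /\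
      exists Psi ds,
        [/\ List.In (Codata T Psi ds) Th,
            perm_eq (unzip1 cocases) (map c_name ds)
          & forall d e, List.In d ds -> List.In (c_name d, Some e) cocases ->
              scoped (size (p_tel c) + size (c_tel d)) e]
  end.

Definition program Th : Prop :=
  [/\ uniq (type_names Th), uniq (producer_names Th), uniq (consumer_names Th)
    & forall D, List.In D Th -> wf_decl Th D].

Definition declares_type Th (T : tname N) (Psi : telescope) : Prop :=
  (exists cs, List.In (Data T Psi cs) Th) \/
  (exists ds, List.In (Codata T Psi ds) Th).

Definition declares_producer Th (T : tname N) (c : psig) : Prop :=
  (exists Psi cs, List.In (Data T Psi cs) Th /\ List.In c cs) \/
  (exists cocases, List.In (Codef T c cocases) Th).

Definition declares_consumer Th (T : tname N) (d : csig) : Prop :=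
  (exists cases, List.In (Def T d cases) Th) \/
  (exists Psi ds, List.In (Codata T Psi ds) Th /\ List.In d ds).

Section Judgments.
Variable Th : program_text.

Inductive wf_ctx : context -> Prop :=
| ctx_nil : wf_ctx [::]
| ctx_cons G t : wf_ctx G -> has_type G t Typ -> wf_ctx (t :: G)

with wf_tel : context -> telescope -> Prop :=
| tel_nil G : wf_ctx G -> wf_tel G [::]
| tel_cons G t Xi :
    has_type G t Typ -> wf_tel (t :: G) Xi -> wf_tel G (t :: Xi)

with has_subst : context -> substitution -> telescope -> Prop :=
| subst_nil G : wf_ctx G -> has_subst G [::] [::]
| subst_cons G e sigma t Xi :
    has_type G e t ->
    has_subst G sigma (subst_tel (inst [:: e]) Xi) ->
    has_subst G (e :: sigma) (t :: Xi)

with eq_subst : context -> substitution -> substitution -> telescope -> Prop :=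
| eq_subst_nil G : wf_ctx G -> eq_subst G [::] [::] [::]
| eq_subst_cons G e e' sigma sigma' t Xi :
    eq_type G e e' t ->
    eq_subst G sigma sigma' (subst_tel (inst [:: e]) Xi) ->
    eq_subst G (e :: sigma) (e' :: sigma') (t :: Xi)

with has_type : context -> expr -> expr -> Prop :=
| ty_var G i t : wf_ctx G -> bound G i t -> has_type G (Var i) t
| ty_typ G : wf_ctx G -> has_type G Typ Typ
| ty_conv G e t t' :
    has_type G e t -> eq_type G t t' Typ -> has_type G e t'
| ty_form G T Psi rho :
    declares_type Th T Psi ->
    has_subst G rho Psi ->
    has_type G (TyCon T rho) Typ
| ty_intro G T c sigma :
    declares_producer Th T c ->
    has_subst G sigma (p_tel c) ->
    has_type G (Prod (p_name c) sigma)
      (TyCon T (map (subst_expr (inst sigma)) (p_args c)))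
| ty_elim G T d e sigma :
    declares_consumer Th T d ->
    has_subst G sigma (c_tel d) ->
    has_type G e (TyCon T (map (subst_expr (inst sigma)) (c_args d))) ->
    has_type G (Dest e (c_name d) sigma)
      (subst_expr (inst (rcons sigma e)) (c_ret d))

with eq_type : context -> expr -> expr -> expr -> Prop :=
| eq_refl G e t : has_type G e t -> eq_type G e e t
| eq_sym G e e' t : eq_type G e e' t -> eq_type G e' e t
| eq_trans G e e' e'' t :
    eq_type G e e' t -> eq_type G e' e'' t -> eq_type G e e'' t
| eq_conv G e e' t t' :
    eq_type G e e' t -> eq_type G t t' Typ -> eq_type G e e' t'
| eq_form G T Psi rho rho' :
    declares_type Th T Psi ->
    eq_subst G rho rho' Psi ->
    eq_type G (TyCon T rho) (TyCon T rho') Typ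
| eq_intro G T c sigma sigma' :
    declares_producer Th T c ->
    eq_subst G sigma sigma' (p_tel c) ->
    eq_type G (Prod (p_name c) sigma) (Prod (p_name c) sigma')
      (TyCon T (map (subst_expr (inst sigma)) (p_args c)))
| eq_elim G T d e e' sigma sigma' :
    declares_consumer Th T d ->
    eq_subst G sigma sigma' (c_tel d) ->
    eq_type G e e' (TyCon T (map (subst_expr (inst sigma)) (c_args d))) ->
    eq_type G (Dest e (c_name d) sigma) (Dest e' (c_name d) sigma')
      (subst_expr (inst (rcons sigma e)) (c_ret d))
| eq_data G T Psi cs c d cases e sigma1 sigma2 :
    List.In (Data T Psi cs) Th ->
    List.In c cs ->
    List.In (Def T d cases) Th ->
    List.In (p_name c, Some e) cases ->
    has_subst G sigma1 (p_tel c) ->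
    has_subst G sigma2 (c_tel d) ->
    eq_subst G (map (subst_expr (inst sigma1)) (p_args c))
               (map (subst_expr (inst sigma2)) (c_args d)) Psi ->
    eq_type G (Dest (Prod (p_name c) sigma1) (c_name d) sigma2)
      (subst_expr (inst (sigma2 ++ sigma1)) e)
      (subst_expr (inst (rcons sigma2 (Prod (p_name c) sigma1))) (c_ret d))
| eq_codata G T Psi ds c d cocases e sigma1 sigma2 :
    List.In (Codata T Psi ds) Th ->
    List.In d ds ->
    List.In (Codef T c cocases) Th ->
    List.In (c_name d, Some e) cocases ->
    has_subst G sigma1 (p_tel c) ->
    has_subst G sigma2 (c_tel d) ->
    eq_subst G (map (subst_expr (inst sigma1)) (p_args c))
               (map (subst_expr (inst sigma2)) (c_args d)) Psi ->
    eq_type G (Dest (Prod (p_name c) sigma1) (c_name d) sigma2)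
      (subst_expr (inst (sigma1 ++ sigma2)) e)
      (subst_expr (inst (rcons sigma2 (Prod (p_name c) sigma1))) (c_ret d)).

End Judgments.

(* Exchanging two adjacent telescopes: turns an expression in the scope of
   Xi1; Xi2 into the same expression in the scope of Xi2; Xi1, where
   m = size Xi1 and n = size Xi2.  With named variables this is the identity. *)
Definition exchange (m n : nat) : expr -> expr :=
  rename (fun i => if i < n then i + m else if i < n + m then i - n else i).

(* The body of the branch labelled [x]; the default [None] is not reached when
   [bs] has a branch for [x], as is always the case in a program. *)
Definition branch (K : eqType) (x : K) (bs : seq (K * option expr)) :
    option expr :=
  nth None (unzip2 bs) (index x (unzip1 bs)).

Definition codefs_of (T : tname N) Th : seq (psig * seq (cname N * option expr)) :=
  pmap (fun D => if D is Codef T' c cocases then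
                   if T' == T then Some (c, cocases) else None
                 else None) Th.

Definition defs_of (T : tname N) Th : seq (csig * seq (pname N * option expr)) :=
  pmap (fun D => if D is Def T' d cases then
                   if T' == T then Some (d, cases) else None
                 else None) Th.

Definition defun_case (d : csig) (f : psig * seq (cname N * option expr)) :
    pname N * option expr :=
  (p_name f.1, omap (exchange (size (p_tel f.1)) (size (c_tel d)))
                    (branch (c_name d) f.2)).

Definition refun_cocase (c : psig) (f : csig * seq (pname N * option expr)) :
    cname N * option expr :=
  (c_name f.1, omap (exchange (size (c_tel f.1)) (size (p_tel c)))
                    (branch (p_name c) f.2)).

Definition defunctionalize (T : tname N) Th : program_text :=
  let fs := codefs_of T Th in
  flatten [seq match D with
               | Codata T' Psi ds =>
                   if T' == T then
                     Data T Psi (unzip1 fs)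
                       :: [seq Def T d (map (defun_case d) fs) | d <- ds]
                   else [:: D]
               | Codef T' _ _ => if T' == T then [::] else [:: D]
               | _ => [:: D]
               end | D <- Th].

Definition refunctionalize (T : tname N) Th : program_text :=
  let fs := defs_of T Th in
  flatten [seq match D with
               | Data T' Psi cs =>
                   if T' == T then
                     Codata T Psi (unzip1 fs)
                       :: [seq Codef T c (map (refun_cocase c) fs) | c <- cs]
                   else [:: D]
               | Def T' _ _ => if T' == T then [::] else [:: D]
               | _ => [:: D]
               end | D <- Th].

Definition is_codata (T : tname N) Th : bool :=
  has (fun D => if D is Codata T' _ _ then T' == T else false) Th.

(* Meaningful for T in [type_names Th]: such a T is declared exactly once, either
   as a codata type or as a data type. *)
Definition transform (T : tname N) Th : program_text :=
  if is_codata T Th then defunctionalize T Th else refunctionalize T Th.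

End Syntax.

Arguments Var {N}.
Arguments Typ {N}.

(* Main.v *)
Require Import Defs.
From mathcomp Require Import all_boot zify.

Set Implicit Arguments.
Unset Strict Implicit.
Unset Printing Implicit Defensive.

(** The judgments consult the program only through the declared types,
    producers and consumers, and through the contracta of the redexes
    [C sigma1 . d sigma2].  Hence a program that keeps all of these validates
    every judgment of the original one.  The transformations keep them: they
    transpose the matrix of bodies indexed by producers and consumers of [T],
    and a body whose two blocks of variables have been exchanged has the same
    instances once the two substitutions are exchanged too. *)

(** * Membership in lists and lookup of branches *)

Section ListMembership.
Variables A B : Type.

Lemma In_flatten_map (f : A -> seq B) x y s :
  List.In x s -> List.In y (f x) -> List.In y (flatten (map f s)).
Proof.
elim: s => //= z s IHs [-> | xs] yfx; apply: List.in_or_app; first by left.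
by right; apply: IHs.
Qed.

Lemma In_pmap (f : A -> option B) x y s :
  List.In x s -> f x = Some y -> List.In y (pmap f s).
Proof.
elim: s => //= z s IHs [-> | xs] fx; first by rewrite fx /=; left.
by case: (f z) => [w|] /=; [right|]; apply: IHs.
Qed.

Lemma In_has (p : pred A) s : has p s -> exists2 x, List.In x s & p x.
Proof.
elim: s => //= x s IHs /orP[px | /IHs[y ys py]]; first by exists x => //; left.
by exists y => //; right.
Qed.

End ListMembership.

Lemma In_flatten (K : eqType) (x : K) ss :
  x \in flatten ss -> exists2 s, List.In s ss & x \in s.
Proof.
elim: ss => //= s ss IHss; rewrite mem_cat => /orP[xs | /IHss[s' s'ss xs']].
  by exists s => //; left.
by exists s' => //; right.
Qed.

Lemma uniq_flatten_In (K : eqType) (s : seq K) ss :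
  uniq (flatten ss) -> List.In s ss -> uniq s.
Proof.
elim: ss => //= s' ss IHss; rewrite cat_uniq => /and3P[us' _ uss] [<- // | sss].
exact: IHss.
Qed.

(** The judgments select a body by membership, the transformations by the first position of its
    label. Distinct labels make the two agree. *)
Lemma branch_In (N : names) (K : eqType) (x : K) (o : option (expr N)) bs :
  uniq (unzip1 bs) -> List.In (x, o) bs -> branch x bs = o.
Proof.
rewrite /branch; elim: bs => //= -[y o'] bs IHbs /= /andP[ybs ubs].
case=> [[-> ->] | xbs].
  by rewrite eqxx.
(* If the head also carried [x], this label would occur again in the tail, against uniqueness. *)
case: eqP => [yx | _]; last exact: IHbs.
case/negP: ybs; rewrite yx {IHbs ubs yx}.
elim: bs xbs => //= p bs IHbs [-> | xbs]; rewrite inE ?eqxx //.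
by rewrite IHbs ?orbT.
Qed.

(** * Renaming, instantiation and the exchange of two blocks of variables *)

Section Transformations.
Variable N : names.
Implicit Types (Th : program_text N) (T : tname N) (c : psig N) (d : csig N).
Implicit Types (e : expr N) (G : context N) (s : substitution N).

(** Arguments of an expression are nested in lists, so the proof is an explicit fixpoint on
    expressions whose recursive calls sit inside inductions on the argument lists. *)
Lemma subst_rename (f : nat -> nat) (s s' : nat -> expr N) :
  (forall i, s (f i) = s' i) ->
  forall e, subst_expr s (rename f e) = subst_expr s' e.
Proof.
move=> sf; fix IHe 1 => -[i | | T r | C r | e d r]; rewrite /rename /= ?sf //.
- by congr TyCon; elim: r => //= e r ->; rewrite -/(rename f e) IHe.
- by congr Prod; elim: r => //= e r ->; rewrite -/(rename f e) IHe.
- congr Dest; first exact: IHe.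
  by elim: r => //= e' r ->; rewrite -/(rename f e') IHe.
Qed.

(** Components are numbered from the right: indices below [size s2] fall in the last block, and the
    others are counted from its end. *)
Lemma inst_cat s1 s2 i :
  inst (s1 ++ s2) i = if i < size s2 then inst s2 i else inst s1 (i - size s2).
Proof.
rewrite /inst size_cat nth_cat; case: (ltnP i (size s2)) => [i2 | le2i].
  by rewrite ltn_addl // -addnBA // ltnNge leq_addr /= addKn.
have -> : (i - size s2 < size s1) = (i < size s1 + size s2) by lia.
case: ltnP => [ilt | _]; last by rewrite addnC subnDA.
have -> : size s1 + size s2 - i.+1 < size s1 by lia.
by congr nth; lia.
Qed.

(** The comparison is made variable by variable. An index of the last block moves up by [size s1]
    and one of the first block moves down by [size s2], so each meets the same component as
    before. *)
Lemma subst_exchange s1 s2 e :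
  subst_expr (inst (s2 ++ s1)) (exchange (size s1) (size s2) e) =
  subst_expr (inst (s1 ++ s2)) e.
Proof.
apply: subst_rename => i; rewrite !inst_cat.
case: (ltnP i (size s2)) => [i2 | le2i].
  by rewrite ltnNge leq_addl /= addnK.
case: (ltnP i (size s2 + size s1)) => [ilt | lei].
  by rewrite ltn_subLR // ilt.
(* Beyond both blocks [exchange] fixes the index, and either order of instantiation lowers it by the
   sum of the two lengths. *)
have -> : (i < size s1) = false by lia.
rewrite /inst.
have -> : (i - size s1 < size s2) = false by lia.
have -> : (i - size s2 < size s1) = false by lia.
by rewrite subnAC.
Qed.

(** * Simulation between programs and transport of derivations *)

Lemma size_subst_tel (s : nat -> expr N) Xi :
  size (subst_tel s Xi) = size Xi.
Proof. by elim: Xi s => //= t Xi IHXi s; rewrite IHXi. Qed.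

(** The transformations call [exchange] with lengths of telescopes, [subst_exchange] with lengths of
    substitutions; for typed substitutions the two agree. *)
Lemma has_subst_size Th G s Xi : has_subst Th G s Xi -> size s = size Xi.
Proof.
elim: s G Xi => [|e s IHs] G Xi H; inversion H; subst => //=.
by rewrite (IHs _ _ H5) size_subst_tel.
Qed.

(** The two computation rules, stripped of their typing premises and merged into one relation, so
    that a redex of one kind may be matched by a redex of the other. [T] stays inside the
    constructors because neither the typing premises nor the conclusions of the rules mention it. *)
Inductive contracts Th Psi c d s1 s2 : expr N -> Prop :=
| contracts_data T cs cases e :
    List.In (Data T Psi cs) Th -> List.In c cs ->
    List.In (Def T d cases) Th -> List.In (p_name c, Some e) cases ->
    contracts Th Psi c d s1 s2 (subst_expr (inst (s2 ++ s1)) e)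
| contracts_codata T ds cocases e :
    List.In (Codata T Psi ds) Th -> List.In d ds ->
    List.In (Codef T c cocases) Th -> List.In (c_name d, Some e) cocases ->
    contracts Th Psi c d s1 s2 (subst_expr (inst (s1 ++ s2)) e).

Lemma eq_contracts Th G Psi c d s1 s2 e :
  contracts Th Psi c d s1 s2 e ->
  has_subst Th G s1 (p_tel c) -> has_subst Th G s2 (c_tel d) ->
  eq_subst Th G (map (subst_expr (inst s1)) (p_args c))
                (map (subst_expr (inst s2)) (c_args d)) Psi ->
  eq_type Th G (Dest (Prod (p_name c) s1) (c_name d) s2) e
    (subst_expr (inst (rcons s2 (Prod (p_name c) s1))) (c_ret d)).
Proof.
by case=> *; [apply: eq_data | apply: eq_codata]; eassumption.
Qed.

(** The length conditions in [sim_contracts] hold at every typed redex and allow an exchanged body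
    to be compared with the original. *)
Record simulates Th Th' : Prop := Simulates {
  sim_type T Psi : declares_type Th T Psi -> declares_type Th' T Psi;
  sim_producer T c : declares_producer Th T c -> declares_producer Th' T c;
  sim_consumer T d : declares_consumer Th T d -> declares_consumer Th' T d;
  sim_contracts Psi c d s1 s2 e :
    size s1 = size (p_tel c) -> size s2 = size (c_tel d) ->
    contracts Th Psi c d s1 s2 e -> contracts Th' Psi c d s1 s2 e }.

Scheme wf_ctx_mind := Minimality for wf_ctx Sort Prop
  with wf_tel_mind := Minimality for wf_tel Sort Prop
  with has_subst_mind := Minimality for has_subst Sort Prop
  with eq_subst_mind := Minimality for eq_subst Sort Prop
  with has_type_mind := Minimality for has_type Sort Prop
  with eq_type_mind := Minimality for eq_type Sort Prop.
Combined Scheme judgments_mind from wf_ctx_mind, wf_tel_mind, has_subst_mind,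
  eq_subst_mind, has_type_mind, eq_type_mind.

Lemma simulates_judgments Th Th' : simulates Th Th' ->
  [/\ forall G, wf_ctx Th G -> wf_ctx Th' G,
      forall G Xi, wf_tel Th G Xi -> wf_tel Th' G Xi,
      forall G s Xi, has_subst Th G s Xi -> has_subst Th' G s Xi &
      [/\ forall G s s' Xi, eq_subst Th G s s' Xi -> eq_subst Th' G s s' Xi,
          forall G e t, has_type Th G e t -> has_type Th' G e t &
          forall G e e' t, eq_type Th G e e' t -> eq_type Th' G e e' t]].
Proof.
move=> sim.
suff: (forall G, wf_ctx Th G -> wf_ctx Th' G) /\
      (forall G Xi, wf_tel Th G Xi -> wf_tel Th' G Xi) /\
      (forall G s Xi, has_subst Th G s Xi -> has_subst Th' G s Xi) /\
      (forall G s s' Xi, eq_subst Th G s s' Xi -> eq_subst Th' G s s' Xi) /\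
      (forall G e t, has_type Th G e t -> has_type Th' G e t) /\
      (forall G e e' t, eq_type Th G e e' t -> eq_type Th' G e e' t).
  by move=> [? [? [? [? []]]]].
apply: judgments_mind.
- exact: ctx_nil.
- by move=> *; apply: ctx_cons.
- by move=> *; apply: tel_nil.
- by move=> *; apply: tel_cons.
- by move=> *; apply: subst_nil.
- by move=> *; apply: subst_cons.
- by move=> *; apply: eq_subst_nil.
- by move=> *; apply: eq_subst_cons.
- by move=> *; apply: ty_var.
- by move=> *; apply: ty_typ.
- by move=> *; apply: ty_conv; eassumption.
- by move=> G T Psi rho /(sim_type sim) *; apply: ty_form; eassumption.
- by move=> G T c s /(sim_producer sim) *; apply: ty_intro.
- by move=> G T d e s /(sim_consumer sim) *; apply: ty_elim; eassumption.
- by move=> *; apply: Defs.eq_refl.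
- by move=> *; apply: Defs.eq_sym.
- by move=> *; apply: eq_trans; eassumption.
- by move=> *; apply: eq_conv; eassumption.
- by move=> G T Psi r r' /(sim_type sim) *; apply: eq_form; eassumption.
- by move=> G T c s s' /(sim_producer sim) *; apply: eq_intro.
- by move=> G T d e e' s s' /(sim_consumer sim) *; apply: eq_elim; eassumption.
(* The typing premises over [Th] give the two lengths; the induction hypotheses give the premises of
   the rule over [Th']. *)
- move=> G T Psi cs c d cases e s1 s2 ? ? ? ? ts1 ? ts2 ? _ ?.
  apply: eq_contracts; try eassumption.
  apply: (sim_contracts sim (has_subst_size ts1) (has_subst_size ts2)).
  by apply: contracts_data; eassumption.
- move=> G T Psi ds c d cocases e s1 s2 ? ? ? ? ts1 ? ts2 ? _ ?.
  apply: eq_contracts; try eassumption.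
  apply: (sim_contracts sim (has_subst_size ts1) (has_subst_size ts2)).
  by apply: contracts_codata; eassumption.
Qed.

(** * Distinctness of branch labels *)

Lemma uniq_cases Th T d cases :
  program Th -> List.In (Def T d cases) Th -> uniq (unzip1 cases).
Proof.
case=> _ uprod _ wf /wf[_ [Psi [cs [inTh pcases _]]]].
(* The labels permute the constructor names of the data type, which form one block of the
   duplicate-free list of all producer names. *)
rewrite (perm_uniq pcases).
exact: uniq_flatten_In uprod (List.in_map (@producer_names_of N) _ _ inTh).
Qed.

Lemma uniq_cocases Th T c cocases :
  program Th -> List.In (Codef T c cocases) Th -> uniq (unzip1 cocases).
Proof.
case=> _ _ ucons wf /wf[_ [Psi [ds [inTh pcocases _]]]].
rewrite (perm_uniq pcocases).
exact: uniq_flatten_In ucons (List.in_map (@consumer_names_of N) _ _ inTh).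
Qed.

(** * Defunctionalization preserves what the judgments consult *)

Section Defunctionalize.
Variables (Th : program_text N) (T : tname N).
Let fs := codefs_of T Th.
Let Th' := defunctionalize T Th.

Lemma codefs_of_In c cocases :
  List.In (Codef T c cocases) Th -> List.In (c, cocases) fs.
Proof. by move=> inTh; apply: In_pmap inTh _; rewrite eqxx. Qed.

Lemma defun_Data T' Psi cs :
  List.In (Data T' Psi cs) Th -> List.In (Data T' Psi cs) Th'.
Proof. by move=> inTh; apply: In_flatten_map inTh _; left. Qed.

Lemma defun_Def T' d cases :
  List.In (Def T' d cases) Th -> List.In (Def T' d cases) Th'.
Proof. by move=> inTh; apply: In_flatten_map inTh _; left. Qed.

Lemma defun_Codata T' Psi ds : T' != T ->
  List.In (Codata T' Psi ds) Th -> List.In (Codata T' Psi ds) Th'.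
Proof.
by move=> neT inTh; apply: In_flatten_map inTh _; rewrite (negPf neT); left.
Qed.

Lemma defun_Codef T' c cocases : T' != T ->
  List.In (Codef T' c cocases) Th -> List.In (Codef T' c cocases) Th'.
Proof.
by move=> neT inTh; apply: In_flatten_map inTh _; rewrite (negPf neT); left.
Qed.

Lemma defun_new_Data Psi ds :
  List.In (Codata T Psi ds) Th -> List.In (Data T Psi (unzip1 fs)) Th'.
Proof. by move=> inTh; apply: In_flatten_map inTh _; rewrite eqxx; left. Qed.

Lemma defun_new_Def Psi ds d :
  List.In (Codata T Psi ds) Th -> List.In d ds ->
  List.In (Def T d (map (defun_case d) fs)) Th'.
Proof.
move=> inTh dds; apply: In_flatten_map inTh _; rewrite eqxx; right.
exact: (List.in_map (fun d => Def T d (map (defun_case d) fs))).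
Qed.

(** Declarations of other types survive. At [T], codefinitions become constructors, destructors
    become definitions, and a codata computation is replayed as a data computation on the transposed
    entry. *)
Lemma defun_simulates : program Th -> is_codata T Th -> simulates Th Th'.
Proof.
move=> wfTh /In_has[[] // T0 Psi0 ds0 inTh0 /eqP eqT0].
rewrite {T0}eqT0 in inTh0.
split=> [T' Psi | T' c | T' d | Psi c d s1 s2 e sz1 sz2].
- case=> -[l inTh]; first by left; exists l; apply: defun_Data.
  have [eqT | neT] := eqVneq T' T; last by right; exists l; apply: defun_Codata.
  rewrite eqT in inTh *.
  by left; exists (unzip1 fs); apply: defun_new_Data inTh.
- case=> [[Psi [cs [inTh ccs]]] | [cocases inTh]].
    by left; exists Psi, cs; split=> //; apply: defun_Data.
  have [eqT | neT] := eqVneq T' T; last first.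
    by right; exists cocases; apply: defun_Codef.
  (* A codefinition does not record the parameters of [T]; [Psi0] comes from the codata declaration
     found by [is_codata]. *)
  rewrite eqT in inTh *; left; exists Psi0, (unzip1 fs); split.
    exact: defun_new_Data inTh0.
  exact: List.in_map fst _ _ (codefs_of_In inTh).
- case=> [[cases inTh] | [Psi [ds [inTh dds]]]].
    by left; exists cases; apply: defun_Def.
  have [eqT | neT] := eqVneq T' T; last first.
    by right; exists Psi, ds; split=> //; apply: defun_Codata.
  rewrite eqT in inTh *; left; exists (map (defun_case d) fs).
  exact: defun_new_Def inTh dds.
- case=> T'.
    move=> cs cases b inTh ccs inTh1 bcases.
    by apply: contracts_data (defun_Data inTh) ccs (defun_Def inTh1) bcases.
  move=> ds cocases b inTh dds inTh1 bcocases.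
  have [eqT | neT] := eqVneq T' T; last first.
    exact: contracts_codata (defun_Codata neT inTh) dds
                            (defun_Codef neT inTh1) bcocases.
  (* A case is instantiated by [s2 ++ s1], a cocase by [s1 ++ s2]; the contractum is rewritten as an
     instance of the exchanged body. *)
  rewrite eqT in inTh inTh1; rewrite -subst_exchange.
  have cfs := codefs_of_In inTh1.
  apply: contracts_data (defun_new_Data inTh) (List.in_map fst _ _ cfs)
                        (defun_new_Def inTh dds) _.
  (* The case of the new definition [d] for [c] looks up the cocase of [c] for [d], which is the
     given body since the labels are distinct. *)
  have := List.in_map (defun_case d) _ _ cfs.
  rewrite /defun_case /= (branch_In (uniq_cocases wfTh inTh1) bcocases) /=.
  by rewrite sz1 sz2.
Qed.

End Defunctionalize.

(** * Refunctionalization preserves what the judgments consult *)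

Section Refunctionalize.
Variables (Th : program_text N) (T : tname N).
Let fs := defs_of T Th.
Let Th' := refunctionalize T Th.

Lemma defs_of_In d cases :
  List.In (Def T d cases) Th -> List.In (d, cases) fs.
Proof. by move=> inTh; apply: In_pmap inTh _; rewrite eqxx. Qed.

Lemma refun_Codata T' Psi ds :
  List.In (Codata T' Psi ds) Th -> List.In (Codata T' Psi ds) Th'.
Proof. by move=> inTh; apply: In_flatten_map inTh _; left. Qed.

Lemma refun_Codef T' c cocases :
  List.In (Codef T' c cocases) Th -> List.In (Codef T' c cocases) Th'.
Proof. by move=> inTh; apply: In_flatten_map inTh _; left. Qed.

Lemma refun_Data T' Psi cs : T' != T ->
  List.In (Data T' Psi cs) Th -> List.In (Data T' Psi cs) Th'.
Proof.
by move=> neT inTh; apply: In_flatten_map inTh _; rewrite (negPf neT); left.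
Qed.

Lemma refun_Def T' d cases : T' != T ->
  List.In (Def T' d cases) Th -> List.In (Def T' d cases) Th'.
Proof.
by move=> neT inTh; apply: In_flatten_map inTh _; rewrite (negPf neT); left.
Qed.

Lemma refun_new_Codata Psi cs :
  List.In (Data T Psi cs) Th -> List.In (Codata T Psi (unzip1 fs)) Th'.
Proof. by move=> inTh; apply: In_flatten_map inTh _; rewrite eqxx; left. Qed.

Lemma refun_new_Codef Psi cs c :
  List.In (Data T Psi cs) Th -> List.In c cs ->
  List.In (Codef T c (map (refun_cocase c) fs)) Th'.
Proof.
move=> inTh ccs; apply: In_flatten_map inTh _; rewrite eqxx; right.
exact: (List.in_map (fun c => Codef T c (map (refun_cocase c) fs))).
Qed.

(** Dual to [defun_simulates]: the data declaration supplies the parameters [Psi0] of the codata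
    type that receives the definitions on [T] as destructors. *)
Lemma refun_simulates Psi0 cs0 :
  program Th -> List.In (Data T Psi0 cs0) Th -> simulates Th Th'.
Proof.
move=> wfTh inTh0.
split=> [T' Psi | T' c | T' d | Psi c d s1 s2 e sz1 sz2].
- case=> -[l inTh]; last by right; exists l; apply: refun_Codata.
  have [eqT | neT] := eqVneq T' T; last by left; exists l; apply: refun_Data.
  rewrite eqT in inTh *.
  by right; exists (unzip1 fs); apply: refun_new_Codata inTh.
- case=> [[Psi [cs [inTh ccs]]] | [cocases inTh]]; last first.
    by right; exists cocases; apply: refun_Codef.
  have [eqT | neT] := eqVneq T' T; last first.
    by left; exists Psi, cs; split=> //; apply: refun_Data.
  rewrite eqT in inTh *; right; exists (map (refun_cocase c) fs).
  exact: refun_new_Codef inTh ccs.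
- case=> [[cases inTh] | [Psi [ds [inTh dds]]]]; last first.
    by right; exists Psi, ds; split=> //; apply: refun_Codata.
  have [eqT | neT] := eqVneq T' T; last first.
    by left; exists cases; apply: refun_Def.
  rewrite eqT in inTh *; right; exists Psi0, (unzip1 fs); split.
    exact: refun_new_Codata inTh0.
  exact: List.in_map fst _ _ (defs_of_In inTh).
- case=> T'; last first.
    move=> ds cocases b inTh dds inTh1 bcocases.
    exact: contracts_codata (refun_Codata inTh) dds (refun_Codef inTh1) bcocases.
  move=> cs cases b inTh ccs inTh1 bcases.
  have [eqT | neT] := eqVneq T' T; last first.
    exact: contracts_data (refun_Data neT inTh) ccs (refun_Def neT inTh1) bcases.
  (* The contractum starts from [s2 ++ s1], so [subst_exchange] applies with the two substitutions
     interchanged, in agreement with the lengths passed by [refun_cocase]. *)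
  rewrite eqT in inTh inTh1; rewrite -subst_exchange.
  have dfs := defs_of_In inTh1.
  apply: contracts_codata (refun_new_Codata inTh) (List.in_map fst _ _ dfs)
                          (refun_new_Codef inTh ccs) _.
  have := List.in_map (refun_cocase c) _ _ dfs.
  rewrite /refun_cocase /= (branch_In (uniq_cases wfTh inTh1) bcases) /=.
  by rewrite sz1 sz2.
Qed.

End Refunctionalize.

(** * Choice between the two transformations *)

Lemma is_codata_In Th T Psi ds :
  List.In (Codata T Psi ds) Th -> is_codata T Th.
Proof.
rewrite /is_codata; elim: Th => //= D Th IHTh [-> | /IHTh ->].
  by rewrite eqxx.
by rewrite orbT.
Qed.

Lemma transform_simulates Th T :
  program Th -> T \in type_names Th -> simulates Th (transform T Th).
Proof.
move=> wfTh /In_flatten[tns tnsTh Ttns]; rewrite /transform.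
case: ifP => [| notcodata]; first exact: defun_simulates.
have /List.in_map_iff[D [Dtns DTh]] := tnsTh.
(* Definitions and codefinitions contribute no type names, and a codata declaration of [T]
   contradicts the failed test, so a data declaration remains. *)
case: D Dtns DTh => [T' Psi cs | ? ? ? | T' Psi ds | ? ? ?] /= tnsE inTh;
  move: Ttns; rewrite -tnsE ?inE // => /eqP TT'; rewrite -TT' in inTh.
  exact: refun_simulates wfTh inTh.
by rewrite (is_codata_In inTh) in notcodata.
Qed.

End Transformations.

Theorem theorem6p3 (N : names) (Th : program_text N) (T : tname N)
    (HTh : program Th) (HT : T \in type_names Th)
    (G : context N) (Xi : telescope N) (e e1 e2 t : expr N)
    (sigma sigma1 sigma2 : substitution N) :
  (has_type Th G e t -> has_type (transform T Th) G e t) /\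
  (eq_type Th G e1 e2 t -> eq_type (transform T Th) G e1 e2 t) /\
  (has_subst Th G sigma Xi -> has_subst (transform T Th) G sigma Xi) /\
  (eq_subst Th G sigma1 sigma2 Xi ->
     eq_subst (transform T Th) G sigma1 sigma2 Xi) /\
  (wf_ctx Th G -> wf_ctx (transform T Th) G) /\
  (wf_tel Th G Xi -> wf_tel (transform T Th) G Xi).
Proof.
have [Hctx Htel Hsubst [Heqs Hty Heq]] :=
  simulates_judgments (transform_simulates HTh HT).
by do !split; auto.
Qed.
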